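(* Let $G$ be a finite noncyclic nilpotent group whose order is divisible by exactly $k$ distinct primes, and suppose $G\in\mathcal{D}_n$. Then $G$ has nilpotency class at most $(n+2-2^k)/2^k$, and the derived length of $G$ is at most $\log_2\big((n+2-2^k)/2^k\big)+1$.
   Context: $\mathcal{D}(G)$ denotes the number of conjugacy classes of nontrivial subgroups $H$ of the finite group $G$ with $N_G(H)\neq H$; $\mathcal{D}_n$ is the family of finite groups $G$ with $\mathcal{D}(G)=n$. *)

(* Defs.v *)
From HB Require Import structures.
From mathcomp Require Import all_boot all_order all_algebra all_fingroup all_solvable.
Set Implicit Arguments. Unset Strict Implicit. Unset Printing Implicit Defensive.
Import GroupScope.

Definition nonselfnorm_subgroups (gT : finGroupType) (G : {set gT}) : {set {set gT}} :=
  [set H : {set gT} | [&& group_set H, H \subset G, H != 1 & 'N_G(H) != H]].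

Definition Dnum (gT : finGroupType) (G : {set gT}) : nat :=
  #|[set (H :^: G) | H in nonselfnorm_subgroups G]|.

(* Main.v *)
(* In a nontrivial nilpotent group only [G] itself is self-normalizing, so [Dnum G + 2] is the
   number c(G) of conjugacy classes of subgroups, and the claim on the class is
   [(nil_class G + 1) * 2 ^ k <= c(G)]. Since c is supermultiplicative on direct products and
   at least 2 on nontrivial groups, it suffices to show [2 (nil_class P + 1) <= c(P)] for a
   noncyclic p-group P. By induction through P / Z(P), two classes of subgroups not containing
   Z(P) are needed; the trivial group is one. If there is no other, then P has a unique
   subgroup of order p, hence is generalized quaternion, and its subgroups are listed directly.
   The derived length bound follows from [G^`(d) \subset 'L_(2 ^ d)(G)]. *)

Require Import Defs.
From mathcomp Require Import all_boot all_order all_algebra all_fingroup all_solvable.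
Set Implicit Arguments. Unset Strict Implicit. Unset Printing Implicit Defensive.
Import GroupScope GRing.Theory Num.Theory.

(** * Counting conjugacy classes of subgroups *)

Definition subgroup_classes (gT : finGroupType) (G : {set gT}) : {set {set {set gT}}} :=
  [set gval H :^: G | H in subgroups G].

Lemma mem_subgroup_classes (gT : finGroupType) (G H : {group gT}) :
  H \subset G -> gval H :^: G \in subgroup_classes G.
Proof. by move=> sHG; apply/imsetP; exists H; rewrite ?inE. Qed.

Lemma mem_conjugates (gT : finGroupType) (G : {group gT}) (A : {set gT}) : A \in A :^: G.
Proof. by apply/imsetP; exists 1; rewrite ?group1 ?conjsg1. Qed.

Lemma conjugates_invariant (gT : finGroupType) (T : Type) (F : {set gT} -> T)
    (G : {group gT}) (A : {set gT}) :
  (forall B g, g \in G -> F (B :^ g) = F B) -> F (repr (A :^: G)) = F A.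
Proof.
move=> invF; have /imsetP[g Gg ->] := mem_repr _ (mem_conjugates G A).
exact: invF.
Qed.

(** By [conjugates_invariant], [F \o repr] is a function on classes that recovers [F H], so
    subgroups with different values of [F] lie in different classes. The explicit counts below all
    exhibit a list [s] and such an [F]. *)
Lemma size_invariant_classes (gT : finGroupType) (T : eqType) (F : {set gT} -> T)
    (G : {group gT}) (s : seq {group gT}) :
    (forall B g, g \in G -> F (B :^ g) = F B) ->
    {in s, forall H : {group gT}, H \subset G} -> uniq [seq F (gval H) | H <- s] ->
  size s <= #|subgroup_classes G|.
Proof.
move=> invF sG uF; pose cl := fun H : {group gT} => gval H :^: G.
have ucl : uniq [seq cl H | H <- s].
  apply: (@map_uniq _ _ (F \o repr)); rewrite -map_comp.
  by rewrite (eq_map (g := fun H => F (gval H))) // => H /=; rewrite conjugates_invariant.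
rewrite -(size_map cl) -(card_uniqP ucl); apply/subset_leq_card/subsetP=> _ /mapP[H sH ->].
exact/mem_subgroup_classes/sG.
Qed.

Lemma conjugates_normal (gT : finGroupType) (G H : {group gT}) :
  H <| G -> gval H :^: G = [set gval H].
Proof.
move=> /andP[_ nHG]; apply/setP=> A; rewrite inE; apply/imsetP/eqP=> [[g Gg ->]|->].
  exact: (normsP nHG).
by exists 1; rewrite ?group1 ?conjsg1.
Qed.

(** By the correspondence theorem each class of [G / N] is the image of a class of [G] whose members
    contain [N]. Restricting to such classes leaves room to count further ones outside. *)
Lemma card_quotient_classes (gT : finGroupType) (G N : {group gT}) : N <| G ->
  #|subgroup_classes (G / N)| <=
  #|[set C in subgroup_classes G | [forall A in C, N \subset A]]|.
Proof.
move=> nsNG; have nNG := normal_norm nsNG.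
apply: leq_trans (leq_imset_card (fun C : {set {set gT}} => [set A / N | A in C]) _).
apply/subset_leq_card/subsetP=> _ /imsetP[Hb sHb ->]; rewrite inE in sHb.
have [H defHb sNH sHG] := inv_quotientS nsNG sHb.
apply/imsetP; exists (gval H :^: G).
  rewrite inE mem_subgroup_classes //=; apply/forall_inP=> _ /imsetP[g Gg ->].
  by rewrite -(normsP nNG g Gg) conjSg.
apply/setP=> A; apply/imsetP/imsetP=> [[gb /morphimP[g Ng Gg ->] ->]|].
  exists (gval H :^ g); first by apply/imsetP; exists g.
  by rewrite defHb quotientJ.
case=> _ /imsetP[g Gg ->] ->; exists (coset N g); first exact: mem_quotient.
by rewrite defHb quotientJ // (subsetP nNG).
Qed.

(** Intersecting with the two factors sends the class of [A <*> B] in [G] to the pair of classes of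
    [A] in [P] and [B] in [K], so all pairs are reached. *)
Lemma card_dprod_classes (gT : finGroupType) (G P K : {group gT}) : P \x K = G ->
  #|subgroup_classes P| * #|subgroup_classes K| <= #|subgroup_classes G|.
Proof.
move=> defG; have [_ defPK cPK tiPK] := dprodP defG.
pose f (C : {set {set gT}}) := ([set A :&: P | A in C], [set A :&: K | A in C]).
rewrite -cardsX; apply: leq_trans (leq_imset_card f _).
suffices fAB (A B : {group gT}) : A \subset P -> B \subset K ->
    (gval A :^: P, gval B :^: K) \in f @: subgroup_classes G.
  apply/subset_leq_card/subsetP=> -[_ _] /setXP[/= /imsetP[A + ->] /imsetP[B + ->]].
  by rewrite !inE; apply: fAB.
move=> sAP sBK.
have sPG : P \subset G by rewrite -defPK mulG_subl.
have sKG : K \subset G by rewrite -defPK mulG_subr.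
have cAB : B \subset 'C(A) by rewrite (subset_trans sBK) // (subset_trans cPK) ?centS.
have sABG : A <*> B \subset G by rewrite join_subG (subset_trans sAP) ?(subset_trans sBK).
have defAB : A <*> B = A * B by rewrite cent_joinEr.
have tiBP : B :&: P = 1 by apply/trivgP; rewrite /= setIC -tiPK setIS.
have tiAK : A :&: K = 1 by apply/trivgP; rewrite /= -tiPK setSI.
have ABP : (A <*> B) :&: P = A.
  by rewrite defAB -group_modl // tiBP mulg1.
have ABK : (A <*> B) :&: K = B.
  by rewrite defAB setIC -group_modr // (setIC K) tiAK mul1g.
have nsP : P <| G by case/dprod_normal2: defG.
have nsK : K <| G by case/dprod_normal2: defG.
apply/imsetP; exists (gval (A <*> B)%G :^: G); first exact: mem_subgroup_classes.
congr pair; apply/setP=> X.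
  apply/imsetP/imsetP=> [[g Pg ->]|[_ /imsetP[g Gg ->] ->]].
    exists ((A <*> B) :^ g); first by apply/imsetP; exists g; rewrite ?(subsetP sPG).
    by rewrite -{1}(conjGid Pg) -conjIg ABP.
  have: g \in P * K by rewrite defPK.
  (* As [K] centralizes [P], conjugating [A] by [g = a * b] is conjugating it by [a] alone. *)
  case/mulsgP=> a b Pa Kb defg; exists a => //.
  rewrite -{1}(normsP (normal_norm nsP) g Gg) -conjIg ABP defg conjsgM.
  apply: (normsP (cents_norm _)) Kb.
  by rewrite (subset_trans cPK) ?centS // -(conjGid Pa) conjSg.
apply/imsetP/imsetP=> [[g Kg ->]|[_ /imsetP[g Gg ->] ->]].
  exists ((A <*> B) :^ g); first by apply/imsetP; exists g; rewrite ?(subsetP sKG).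
  by rewrite -{1}(conjGid Kg) -conjIg ABK.
have: g \in P * K by rewrite defPK.
case/mulsgP=> a b Pa Kb defg; exists b => //.
rewrite -{1}(normsP (normal_norm nsK) g Gg) -conjIg ABK defg conjsgM.
congr (_ :^ _); apply: (normsP (cents_norm _)) Pa.
by rewrite centsC (subset_trans sBK).
Qed.

(** No element generates [P], so each lies in a maximal subgroup; an element [y] outside one maximal
    subgroup [M] gives a second one, [L]. With [P] and [1] these represent four classes. *)
Lemma noncyclic_pgroup_classes (gT : finGroupType) (p : nat) (P : {group gT}) :
  p.-group P -> ~~ cyclic P -> 3 < #|subgroup_classes P|.
Proof.
move=> pP ncP.
have maxP x : x \in P -> exists2 M : {group gT}, maximal M P & x \in M.
  rewrite -cycle_subG => /maximal_exists[e|[M maxM sM]].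
    by case/cyclicP: ncP; exists x; rewrite -e.
  by exists M; rewrite // -cycle_subG.
have ntP : P :!=: 1 by apply: contraNneq ncP => ->; exact: cyclic1.
have [x Px ntx] := trivgPn _ ntP.
have [M maxM Mx] := maxP x Px.
have [sMP [y Py nMy]] := properP (maxgroupp maxM).
have [L maxL Ly] := maxP y Py.
have [sLP _] := andP (maxgroupp maxL).
have nsL := p_maximal_normal pP maxL.
(* [M] and [L] both have index [p], so their order does not separate them; the test [A == L] does,
   and it is invariant because [L] is normal. *)
apply: (@size_invariant_classes _ _ (fun A => (#|A|, A == L)) _ [:: P; M; L; 1%G]).
- move=> B g Pg; rewrite cardJg -{1}(normsP (normal_norm nsL) g Pg).
  by rewrite (inj_eq (@conjsg_inj _ g)).
- by move=> H; rewrite !inE => /or4P[] /eqP-> //; rewrite ?sub1G.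
have ltM : #|M| < #|P| by rewrite proper_card // (maxgroupp maxM).
have ltL : #|L| < #|P| by rewrite proper_card // (maxgroupp maxL).
have gtM : 1 < #|M| by rewrite cardG_gt1; apply/trivgPn; exists x.
have gtL : 1 < #|L|.
  rewrite cardG_gt1; apply/trivgPn; exists y => //.
  by apply: contraNneq nMy => ->; exact: group1.
have neML : (gval M == L) = false by apply: contraNF nMy => /eqP->.
have neL1 : (1 == gval L) = false by rewrite eq_sym; apply/eqP=> e; rewrite e cards1 in gtL.
rewrite /= !inE !xpair_eqE !negb_or eqxx neML neL1 !andbF !andbT /= cards1.
by rewrite !gtn_eqF //= ?(ltn_trans gtM ltM).
Qed.

(** * Lower central series and derived length *)

Lemma lcn_comm_sub (gT : finGroupType) (G : {group gT}) m n :
  [~: 'L_m.+1(G), 'L_n.+1(G)] \subset 'L_(m + n).+2(G).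
Proof.
elim: m n => [|m IHm] n; first by rewrite lcn1 commGC -lcnSn.
have nsN := lcn_normal (m.+1 + n).+2 G; set N := 'L_(m.+1 + n).+2(G) in nsN *.
have nNG := normal_norm nsN.
(* The three subgroups lemma concerns trivial commutators, so inclusions in [N] are turned into
   triviality in [G / N]. *)
have q1 (A B C : {group gT}) : A \subset G -> B \subset G -> C \subset G ->
    ([~: A / N, B / N, C / N] == 1) = ([~: A, B, C] \subset N).
  move=> sA sB sC; have nA := subset_trans sA nNG; have nB := subset_trans sB nNG.
  have nC := subset_trans sC nNG.
  have sAB : [~: A, B] \subset G by rewrite (subset_trans (commgSS sA sB)) ?(der_sub 1).
  have nAB := subset_trans sAB nNG.
  by rewrite -!quotientR // -subG1 quotient_sub1 // comm_subG.
rewrite lcnSn -q1 ?lcn_sub //.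
apply/eqP; apply: three_subgroup; apply/eqP; rewrite q1 ?lcn_sub //=.
  by rewrite [[~: G, _]]commGC -lcnSn commGC /N addSnnS IHm.
by rewrite (commGC 'L_n.+1(G)) (subset_trans (commSg _ (IHm n))).
Qed.

Lemma der_sub_lcn (gT : finGroupType) (G : {group gT}) d : G^`(d) \subset 'L_(2 ^ d)(G).
Proof.
elim: d => [|d IHd]; first by rewrite derg0 lcn1.
rewrite dergSn (subset_trans (commgSS IHd IHd)) //.
rewrite expnS mul2n -addnn -[(2 ^ d)%N]prednK ?expn_gt0 //.
by rewrite addSn addnS lcn_comm_sub.
Qed.

Lemma nilpotent_derived_length (gT : finGroupType) (G : {group gT}) :
  nilpotent G -> G :!=: 1 -> exists d, G^`(d.+1) = 1 /\ 2 ^ d <= nil_class G.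
Proof.
move=> nilG ntG; have c_gt0 : 0 < nil_class G by rewrite lt0n nil_class0.
exists (trunc_log 2 (nil_class G)); split; last exact: trunc_logP.
apply/trivgP; apply: subset_trans (der_sub_lcn _ _) _.
rewrite -[(2 ^ _)%N]prednK ?expn_gt0 //.
have -> : 'L_(2 ^ (trunc_log 2 (nil_class G)).+1).-1.+1(G) = 1; last exact: subxx.
apply/lcn_nil_classP => //; rewrite -ltnS prednK ?expn_gt0 //.
exact: trunc_log_ltn.
Qed.

(** * Noncyclic p-groups *)

(* Representatives: the [n] subgroups [A i] of the cyclic maximal subgroup [<[x]>],
   the [n.-1] subgroups [B i = A i <*> <[y]>], and the maximal subgroup [Mxy]. *)
Lemma quaternion_classes (gT : finGroupType) (G : {group gT}) n :
  2 < n -> G \isog 'Q_(2 ^ n) -> n.*2 <= #|subgroup_classes G|.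
Proof.
move=> n_gt2 isoG; have [[x y] genG [_ y2 _]] := generators_quaternion n_gt2 isoG.
have [_ Gx ox /setDP[Gy nXy]] := genG.
have [pG _ nsXG defG _] := extremal_generators_facts (isT : prime 2) genG.
have [_ _ _ [_ maxG] _] := quaternion_structure n_gt2 genG isoG.
(* Since [x * y] and [y] generate [G], the proper subgroup [Mxy] omits [y]; this tells it apart from
   every [B i]. *)
set Mxy := <<(x * y) ^: G>> in maxG; have maxM : maximal Mxy G by rewrite maxG /= eqxx !orbT.
have Mxyxy : x * y \in Mxy by apply/mem_gen/class_refl.
have nMy : y \notin Mxy.
  apply/negP=> My; have Mx : x \in Mxy by rewrite -(groupMr x My).
  have := maxgroupp maxM; rewrite properE => /andP[_ /negP[]].
  by rewrite -{1}defG mul_subG ?cycle_subG.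
have n1 : n = n.-1.+1 by rewrite prednK // (ltn_trans _ n_gt2).
have sXG : <[x]> \subset G by rewrite cycle_subG.
have sYG : <[y]> \subset G by rewrite cycle_subG.
pose A i := <[x ^+ (2 ^ i)%N]>%G; pose B i := (A i <*> <[y]>)%G.
have sAX i : A i \subset <[x]> by rewrite cycleX.
have sBG i : B i \subset G by rewrite join_subG (subset_trans (sAX i)).
have oA i : i < n -> #|A i| = (2 ^ (n.-1 - i))%N.
  rewrite n1 ltnS => le_i; rewrite -orderE orderXdiv ox; first by rewrite expnB.
  exact: dvdn_exp2l.
have nsA i : A i <| G.
  exact: char_normal_trans (cycle_subgroup_char (sAX i)) nsXG.
(* By the modular law it suffices that [<[y]>] meets [<[x]>] inside [A i], which holds once
   [y ^+ 2 = x ^+ (2 ^ n.-2)] is in [A i]. At [i = n.-1] this fails: [A i] is trivial and [B i]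
   equals [B n.-2]. *)
have BX i : i < n.-1 -> B i :&: <[x]> = A i.
  move=> lt_i; have := nsA i => /andP[_ nA].
  rewrite /= norm_joinEr ?(subset_trans sYG) // -group_modl ?sAX //.
  apply/mulGidPl; apply/subsetP=> z /setIP[/cycleP[k ->]].
  have Ay2 : y ^+ 2 \in A i.
    rewrite y2 -(subnK (_ : i <= n.-2)); last by rewrite -ltnS prednK // -ltnS -n1 ltnW.
    by rewrite expnD mulnC expgM mem_cycle.
  rewrite -(odd_double_half k) -mul2n expgD [y ^+ (2 * _)]expgM.
  have {}Ay2 : (y ^+ 2) ^+ k./2 \in A i by rewrite groupX.
  rewrite (groupMr _ (subsetP (sAX i) _ Ay2)) (groupMr _ Ay2).
  by case: (odd k) => [|_]; rewrite ?group1 // expg1 (negPf nXy).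
(* The first entry isolates [Mxy], the second separates the [A i] from the [B i], the third recovers
   [i]. All are invariant as [Mxy] and [<[x]>] are normal. *)
pose F (C : {set gT}) := (C == Mxy, C \subset <[x]>, #|C :&: <[x]>|).
have FA i : i < n -> F (A i) = (false, true, 2 ^ (n.-1 - i))%N.
  move=> lt_i; rewrite /F sAX (setIidPl (sAX i)) oA //; congr (_, _, _).
  apply: contraNF nXy => /eqP eA; rewrite -(groupMl y (cycle_id x)).
  by apply: (subsetP (sAX i)); rewrite eA.
have FB i : i < n.-1 -> F (B i) = (false, false, 2 ^ (n.-1 - i))%N.
  move=> lt_i; have By : y \in B i by rewrite mem_gen // inE cycle_id orbT.
  rewrite /F BX // oA; last by rewrite n1 ltnS ltnW.
  congr (_, _, _); first by apply: contraNF nMy => /eqP <-.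
  by apply: contraNF nXy => /subsetP->.
pose s := <<(x * y) ^: G>>%G :: [seq A i | i <- iota 0 n] ++ [seq B i | i <- iota 0 n.-1].
have <- : size s = n.*2.
  by rewrite /= size_cat !size_map !size_iota -addnS -n1 addnn.
apply: (@size_invariant_classes _ _ F).
- move=> C g Gg; have nM : Mxy :^ g = Mxy := normsP (normal_norm (p_maximal_normal pG maxM)) g Gg.
  have nX : <[x]> :^ g = <[x]> := normsP (normal_norm nsXG) g Gg.
  rewrite /F -{1}nM (inj_eq (@conjsg_inj _ g)) -{1}nX conjSg; congr (_, _, _).
  by rewrite -{1}nX -conjIg cardJg.
- move=> H; rewrite inE mem_cat => /or3P[/eqP->|/mapP[i _ ->]|/mapP[i _ ->]] //.
    by case/andP: (maxgroupp maxM).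
  exact: subset_trans sXG.
have injF b c m : m <= n -> uniq [seq (b, c, 2 ^ (n.-1 - i))%N | i <- iota 0 m].
  move=> le_m; rewrite map_inj_in_uniq ?iota_uniq // => i j.
  rewrite !mem_iota !add0n /= => lt_i lt_j [] /eqP.
  rewrite eqn_exp2l // => /eqP e.
  have {}lt_i : i <= n.-1 by rewrite -ltnS -n1 (leq_trans lt_i).
  have {}lt_j : j <= n.-1 by rewrite -ltnS -n1 (leq_trans lt_j).
  by rewrite -(subKn lt_i) e subKn.
have mFA : [seq F (gval H) | H <- [seq A i | i <- iota 0 n]]
    = [seq (false, true, 2 ^ (n.-1 - i))%N | i <- iota 0 n].
  by rewrite -map_comp; apply/eq_in_map=> i; rewrite mem_iota => /FA.
have mFB : [seq F (gval H) | H <- [seq B i | i <- iota 0 n.-1]]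
    = [seq (false, false, 2 ^ (n.-1 - i))%N | i <- iota 0 n.-1].
  by rewrite -map_comp; apply/eq_in_map=> i; rewrite mem_iota => /FB.
rewrite map_cons map_cat mFA mFB cons_uniq cat_uniq !injF ?leq_pred // andbT /=.
rewrite mem_cat /F eqxx; apply/andP; split.
  by apply/norP; split; apply/mapP=> -[].
by apply/hasPn=> _ /mapP[i _ ->]; apply/mapP=> -[].
Qed.

(** The classes of [1] and of [H] are distinct, and each has a member not containing [N], so neither
    is among those coming from [G / N]. *)
Lemma card_quotient_classes_add2 (gT : finGroupType) (G N H : {group gT}) :
    N <| G -> N :!=: 1 -> H \subset G -> H :!=: 1 -> ~~ (N \subset H) ->
  #|subgroup_classes (G / N)|.+2 <= #|subgroup_classes G|.
Proof.
move=> nsNG ntN sHG ntH nNH.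
have := card_quotient_classes nsNG; set S := [set C in _ | _] => leS.
have nS (K : {group gT}) : ~~ (N \subset K) -> gval K :^: G \notin S.
  apply: contra; rewrite inE => /andP[_ /forall_inP]; apply; exact: mem_conjugates.
have nH1 : gval H :^: G != gval 1%G :^: G.
  apply/eqP=> e; have := mem_conjugates G H; rewrite e => /imsetP[g _].
  by rewrite conjs1g; apply/eqP.
have sub : [set gval H :^: G; gval 1%G :^: G] :|: S \subset subgroup_classes G.
  apply/subsetP=> C /setUP[/set2P[] -> | /setIdP[] //];
    by apply: mem_subgroup_classes; rewrite ?sub1G.
apply: leq_trans (subset_leq_card sub); rewrite cardsU disjoint_setI0.
  by rewrite cards0 subn0 cards2 nH1 add2n !ltnS.
apply/pred0Pn=> -[C /andP[/set2P[]-> /=]]; apply/negP/nS => //.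
by rewrite subG1.
Qed.

(* The center is then the only subgroup of order [p]. *)
Lemma card_Ohm1_center_minimal (gT : finGroupType) (p : nat) (P : {group gT}) :
    p.-group P -> P :!=: 1 ->
    (forall H : {group gT}, H \subset P -> H :!=: 1 -> 'Z(P) \subset H) ->
  #|'Ohm_1(P)| = p.
Proof.
move=> pP ntP minZ; have [p_pr _ _] := pgroup_pdiv pP ntP.
have pZ := pgroupS (center_sub P) pP.
have ntZ : 'Z(P) != 1 by apply: contra ntP => /eqP/(trivg_center_pgroup pP)->.
(* A subgroup of order [p] contains the nontrivial p-group ['Z(P)], whose order is at least [p];
   hence they coincide. *)
have minZc x : x \in P -> #[x] = p -> <[x]> = 'Z(P).
  move=> Px ox; apply/eqP; rewrite eq_sym eqEcard minZ ?cycle_subG //=; last first.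
    by rewrite -cardG_gt1 -orderE ox prime_gt1.
  have [_ dvdp _] := pgroup_pdiv pZ ntZ.
  by rewrite -orderE ox dvdn_leq ?cardG_gt0.
have [_ /(Cauchy p_pr)[z Zz oz] _] := pgroup_pdiv pZ ntZ.
have Pz := subsetP (center_sub P) z Zz.
suffices ->: 'Ohm_1(P) = <[z]> by rewrite -orderE.
apply/eqP; rewrite eqEsubset (OhmE 1 pP) gen_subG; apply/andP; split.
  apply/subsetP=> x /LdivP[Px]; rewrite expn1 => xp.
  have [->|ntx] := eqVneq x 1; first exact: group1.
  by rewrite /= (minZc z) // -(minZc x) ?cycle_id //; apply: nt_prime_order.
by rewrite cycle_subG mem_gen // !inE Pz expn1 -oz expg_order /=.
Qed.

Lemma pgroup_classes (gT : finGroupType) (p : nat) (P : {group gT}) :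
  p.-group P -> ~~ cyclic P -> (nil_class P).+1.*2 <= #|subgroup_classes P|.
Proof.
have [m] := ubnP #|P|; elim: m => // m IHm in gT P * => /ltnSE-leP pP ncP.
have nilP := pgroup_nil pP.
have ntP : P :!=: 1 by apply: contraNneq ncP => ->; exact: cyclic1.
have [cPP|ncPP] := boolP (abelian P).
  apply: leq_trans (noncyclic_pgroup_classes pP ncP).
  by rewrite -nil_class1 -ltnS in cPP; rewrite (leq_double _ 2).
have ntZ : 'Z(P) != 1 by apply: contra ntP => /eqP/(trivg_center_pgroup pP)->.
(* Dividing by the center lowers the class by one, and the quotient stays noncyclic because [P] is
   not abelian. *)
have IH : (nil_class P).*2 <= #|subgroup_classes (P / 'Z(P))|.
  have -> : nil_class P = (nil_class (P / 'Z(P))).+1.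
    by rewrite nil_class_quotient_center // prednK // lt0n nil_class0.
  apply: IHm; rewrite ?quotient_pgroup //.
    by apply: leq_trans leP; rewrite ltn_quotient ?center_sub.
  by apply: contra ncPP => /cyclic_center_factor_abelian.
have [/existsP[H /and3P[sHP ntH nZH]] | noH] :=
    boolP [exists H : {group gT}, [&& H \subset P, H :!=: 1 & ~~ ('Z(P) \subset H)]].
  rewrite doubleS (leq_trans _ (card_quotient_classes_add2 _ _ sHP ntH nZH)) //.
  exact: center_normal.
have minZ (H : {group gT}) : H \subset P -> H :!=: 1 -> 'Z(P) \subset H.
  move=> sHP ntH; apply: contraR noH => nZH; apply/existsP; exists H.
  by rewrite sHP ntH nZH.
(* A p-group whose ['Ohm_1] has order [p] is cyclic or generalized quaternion. In order [2 ^ n] the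
   latter has class [n.-1], so the required count is exactly [n.*2]. *)
have := introT (prime_Ohm1P pP ntP) (card_Ohm1_center_minimal pP ntP minZ).
rewrite (negPf ncP) => /andP[_ /eqP/quaternion_classP[n n_gt2 isoP]].
have [[x y] genP _] := generators_quaternion n_gt2 isoP.
have [_ [_ _ _ ->] _ _ _] := quaternion_structure n_gt2 genP isoP.
by rewrite prednK ?quaternion_classes // (ltn_trans _ n_gt2).
Qed.

(** * Nilpotent groups as products of their p-cores *)

Lemma card_pcore_nilpotent (gT : finGroupType) (G : {group gT}) (pi : nat_pred) :
  nilpotent G -> #|'O_pi(G)| = (#|G|`_pi)%N.
Proof. by move=> nilG; apply/card_Hall/nilpotent_pcore_Hall. Qed.

Lemma size_primes_partC (n p : nat) : p \in primes n ->
  size (primes n) = (size (primes (n`_p^')%N)).+1.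
Proof.
move=> np; rewrite primes_part size_filter -(count_predC (pred1 p)).
rewrite (count_uniq_mem _ (primes_uniq n)) np add1n; congr _.+1.
Qed.

Lemma nilpotent_classes_pcoreC (gT : finGroupType) (G : {group gT}) p : nilpotent G ->
  #|subgroup_classes 'O_p(G)| * #|subgroup_classes 'O_p^'(G)| <= #|subgroup_classes G|.
Proof. by move=> nilG; apply/card_dprod_classes/nilpotent_pcoreC. Qed.

Lemma nontrivial_classes (gT : finGroupType) (G : {group gT}) :
  G :!=: 1 -> 1 < #|subgroup_classes G|.
Proof.
move=> ntG.
apply: (@size_invariant_classes _ _ (fun A => #|A|) _ [:: G; 1%G]).
- by move=> B g _; rewrite cardJg.
- by move=> H; rewrite !inE => /orP[] /eqP-> //; rewrite sub1G.
by rewrite /= inE cards1 gtn_eqF // cardG_gt1.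
Qed.

(** Each prime divisor splits off a nontrivial direct factor ['O_p(G)], which contributes at least a
    factor 2. *)
Lemma nilpotent_classes_primes (gT : finGroupType) (G : {group gT}) :
  nilpotent G -> 2 ^ size (primes #|G|) <= #|subgroup_classes G|.
Proof.
move def_k: (size _) => k nilG; elim: k => [|k IHk] in G nilG def_k *.
  rewrite card_gt0; apply/set0Pn; exists (gval G :^: G).
  exact: mem_subgroup_classes.
have [p Gp] : exists p, p \in primes #|G|.
  by case: (primes _) def_k => // p s _; exists p; rewrite inE eqxx.
apply: leq_trans (nilpotent_classes_pcoreC p nilG); rewrite expnS leq_mul //.
  rewrite nontrivial_classes // -cardG_gt1 card_pcore_nilpotent //.
  by rewrite p_part_gt1.
apply: IHk; first exact: nilpotentS (pcore_sub _ _) nilG.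
rewrite card_pcore_nilpotent //; apply: succn_inj.
by rewrite -size_primes_partC.
Qed.

(** Proper subgroups of a nilpotent group are smaller than their normalizers, so [Dnum] misses
    exactly the singleton classes of [1] and [G], distinct since [G] is nontrivial. *)
Lemma nilpotent_classes_Dnum (gT : finGroupType) (G : {group gT}) :
  nilpotent G -> G :!=: 1 -> #|subgroup_classes G| = (Dnum G).+2.
Proof.
move=> nilG ntG; set D := [set H :^: G | H in nonselfnorm_subgroups G].
have cl1 : gval 1%G :^: G = [set 1] by exact/conjugates_normal/normal1.
have clG : gval G :^: G = [set gval G] by exact/conjugates_normal/normal_refl.
have -> : subgroup_classes G = [set gval G] |: ([set 1] |: D).
  apply/setP=> C; rewrite 2!in_setU1; apply/imsetP/or3P=> [[H]|].
    rewrite inE => sHG ->.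
    have [->|ntH] := eqVneq H 1%G; first by rewrite cl1 eqxx; constructor 2.
    have [->|neG] := eqVneq H G; first by rewrite clG eqxx; constructor 1.
    constructor 3; apply/imsetP; exists (gval H) => //.
    rewrite inE groupP sHG ntH /=.
    have /properP[_ [x Nx nHx]] : H \proper 'N_G(H).
      by apply: nilpotent_proper_norm => //; rewrite properEneq neG.
    by apply: contraNneq nHx => <-.
  case=> [/eqP->|/eqP->|/imsetP[A]]; first by exists G; rewrite ?inE ?clG.
    by exists 1%G; rewrite ?inE ?sub1G ?cl1.
  by rewrite inE => /and4P[gA sAG _ _] ->; exists (Group gA); rewrite ?inE.
have nDcl A : A \notin nonselfnorm_subgroups G -> [set A] \notin D.
  apply: contra => /imsetP[B DB eAB].
  by have := mem_conjugates G B; rewrite -eAB => /set1P <-.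
rewrite !cardsU1 in_setU1 (inj_eq set1_inj) (negPf ntG) !nDcl ?inE ?eqxx ?andbF //.
by rewrite (setIidPl (normG G)) eqxx !andbF.
Qed.

(** If [G] is abelian, any noncyclic Sylow subgroup serves. Otherwise take [p] dividing the order of
    the last nontrivial lower central term; the resulting class, at least 2, makes ['O_p(G)]
    noncyclic. *)
Lemma nilpotent_Sylow_class (gT : finGroupType) (G : {group gT}) :
    nilpotent G -> ~~ cyclic G ->
  exists p, [/\ p \in primes #|G|, ~~ cyclic 'O_p(G)
               & nil_class G <= nil_class 'O_p(G)].
Proof.
move=> nilG ncG.
have nilO p : nilpotent 'O_p(G) by exact: nilpotentS (pcore_sub _ _) nilG.
have primeG (p : nat) : 'O_p(G) != 1 -> p \in primes #|G|.
  by rewrite -cardG_gt1 card_pcore_nilpotent // p_part_gt1.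
have ntO (p : nat) : ~~ cyclic 'O_p(G) -> 'O_p(G) != 1.
  by apply: contraNneq => ->; exact: cyclic1.
have [cGG|ncGG] := boolP (abelian G).
  have [ZG|] := boolP (Zgroup G); first by rewrite nil_Zgroup_cyclic in ncG.
  case/forall_inPn=> S /SylowP[p _ sylS]; rewrite (nilpotent_Hall_pcore nilG sylS) => ncS.
  exists p; split=> //; first exact/primeG/ntO.
  by rewrite -nil_class1 in cGG; rewrite (leq_trans cGG) // lt0n nil_class0 ntO.
have c_gt1 : 1 < nil_class G by rewrite ltnNge nil_class1.
move defc: (nil_class G) c_gt1 => c c_gt1; rewrite -(ltn_predK c_gt1).
have ntL : 'L_c(G) != 1.
  rewrite -(ltn_predK c_gt1); apply/eqP=> /(lcn_nil_classP _ nilG).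
  by rewrite defc -ltnS (ltn_predK c_gt1) ltnn.
have [p p_pr pL] : exists2 p, prime p & p %| #|'L_c(G)|.
  by exists (pdiv #|'L_c(G)|); rewrite ?pdiv_dvd ?pdiv_prime ?cardG_gt1.
(* Were the class of ['O_p(G)] below [c], its term ['L_c] would vanish and ['L_c(G)] would equal
   that of ['O_p^'(G)], a p'-group, against the choice of [p]. *)
have lec : c.-1 < nil_class 'O_p(G).
  rewrite ltnNge; apply/negP=> /(lcn_nil_classP _ (nilO p)) L1.
  have := lcn_dprod c (nilpotent_pcoreC p nilG).
  rewrite -{1}(ltn_predK c_gt1) L1 dprod1g => defL.
  have : p^'.-group 'L_c(G).
    by rewrite -defL (pgroupS (lcn_sub _ _)) ?pcore_pgroup.
  by rewrite /pgroup p'natE // pL.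
have ncO : ~~ cyclic 'O_p(G).
  apply/negP=> /cyclic_abelian; rewrite -nil_class1 leqNgt => /negP[].
  by apply: leq_trans lec; rewrite (ltn_predK c_gt1).
by exists p; split=> //; exact/primeG/ntO.
Qed.

Lemma nilpotent_classes_bound (gT : finGroupType) (G : {group gT}) :
  nilpotent G -> ~~ cyclic G ->
  (nil_class G).+1 * 2 ^ size (primes #|G|) <= #|subgroup_classes G|.
Proof.
move=> nilG ncG; have [p [Gp ncP leP]] := nilpotent_Sylow_class nilG ncG.
apply: leq_trans (nilpotent_classes_pcoreC p nilG).
rewrite (size_primes_partC Gp) expnS mulnA muln2 leq_mul //.
  apply: leq_trans (pgroup_classes (pcore_pgroup _ _) ncP).
  by rewrite leq_double ltnS.
rewrite -card_pcore_nilpotent // nilpotent_classes_primes //.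
exact: nilpotentS (pcore_sub _ _) nilG.
Qed.

Theorem mainTheorem7 (gT : finGroupType) (G : {group gT}) (n k : nat) :
  nilpotent G -> ~~ cyclic G ->
  size (primes #|G|) = k ->
  Dnum G = n ->
  let x : rat := ((n%:R + 2 - 2 ^+ k) / 2 ^+ k)%R in
  ((nil_class G)%:R <= x)%R /\
  (exists d : nat, G^`(d) = 1 /\ (d = 0 \/ (2 ^+ d.-1 <= x)%R)).
Proof.
move=> nilG ncG def_k def_n x.
have ntG : G :!=: 1 by apply: contraNneq ncG => ->; exact: cyclic1.
(* Cleared of denominators, [m <= x] reads [(m + 1) * 2 ^ k <= n + 2]. It is used both for the class
   itself and for a power of 2 below it. *)
have le_x m : m <= nil_class G -> (m%:R <= x)%R.
  move=> le_m; rewrite /x ler_pdivlMr ?exprn_gt0 // lerBrDr -{2}[(2 ^+ k)%R]mul1r -mulrDl.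
  rewrite natr1 -natrX -natrM -natrD ler_nat addn2.
  rewrite -def_n -nilpotent_classes_Dnum // -def_k.
  by apply: leq_trans (nilpotent_classes_bound nilG ncG); rewrite leq_mul2r ltnS le_m orbT.
split; first exact: le_x.
have [d [Gd le_d]] := nilpotent_derived_length nilG ntG.
(* For the exponent [d.+1], the inequality [2 ^ d <= x] is the logarithmic bound in exponential
   form. *)
by exists d.+1; split=> //; right; rewrite -natrX le_x.
Qed.
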